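(* Let $1<p<\infty$ and $1<q\le p$. For every pair of functions $u_0,u_1:\mathbb{R}^N\to[0,+\infty)$, define \[ \sigma_t(x)=\Big[(1-t)\, u_0(x)^q+t\, u_1(x)^q\Big]^\frac{1}{q},\qquad t\in[0,1],\ x\in\mathbb{R}^N. \] Then \[ |\sigma_t(x)-\sigma_t(y)|^p\le (1-t)\, |u_0(x)-u_0(y)|^p+t\, |u_1(x)-u_1(y)|^p,\qquad t\in[0,1],\ x,y\in\mathbb{R}^N. \] *)

(* Defs.v *)
From mathcomp Require Import all_boot all_order all_algebra.
From mathcomp Require Import all_classical all_reals all_analysis.

Set Implicit Arguments.
Unset Strict Implicit.
Unset Printing Implicit Defensive.

Import Order.TTheory GRing.Theory Num.Theory.
Local Open Scope ring_scope.

(* Every real power below has a nonnegative base and a positive exponent, the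
   range on which [powR] is the usual power, including 0 `^ q = 0. *)
Definition sigma (R : realType) (N : nat) (q : R) (u0 u1 : 'rV[R]_N -> R)
    (t : R) (x : 'rV[R]_N) : R :=
  ((1 - t) * u0 x `^ q + t * u1 x `^ q) `^ (1 / q).

(* Main.v *)
(** For fixed [t], [sigma] is the norm [(a, b) |-> ((1-t) a^q + t b^q)^(1/q)]
    evaluated at [(u0 x, u1 x)]. Minkowski's inequality for this norm bounds
    the increment of [sigma] by the norm of the increments of [u0] and [u1], and
    convexity of [s |-> s^(p/q)] then passes from the exponent [q] to [p]. *)
Require Import Defs.
From mathcomp Require Import all_boot all_order all_algebra.
From mathcomp Require Import all_classical all_reals all_analysis.
From mathcomp Require Import ring lra.

Import Order.TTheory GRing.Theory Num.Theory.
Local Open Scope ring_scope.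

Lemma powR_conv_le (R : realType) (r t x y : R) :
  1 <= r -> 0 <= t <= 1 -> 0 <= x -> 0 <= y ->
  ((1 - t) * x + t * y) `^ r <= (1 - t) * x `^ r + t * y `^ r.
Proof.
move=> r1 /andP[t0 t1] x0 y0.
have := @convex_powR R r r1 (Itv01 t0 t1) y x.
rewrite !inE /= !in_itv /= !andbT !convRE /unstable.onem /=.
by move=> /(_ y0 x0); rewrite addrC [((1 - t) * x + _)]addrC.
Qed.

Definition wmean {R : realType} (q t a b : R) : R :=
  ((1 - t) * a `^ q + t * b `^ q) `^ (1 / q).

Section WeightedMean.
Context {R : realType} {q t : R}.
Hypotheses (q1 : 1 <= q) (t01 : 0 <= t <= 1).

Let q0 : 0 < q. Proof. exact: lt_le_trans q1. Qed.

Let wsum_ge0 (a b : R) : 0 <= (1 - t) * a `^ q + t * b `^ q.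
Proof.
by case/andP: t01 => t0 t1; rewrite addr_ge0// mulr_ge0 ?subr_ge0 ?powR_ge0.
Qed.

Lemma wmean_powR (a b : R) :
  wmean q t a b `^ q = (1 - t) * a `^ q + t * b `^ q.
Proof. by rewrite -powRrM div1r mulVf ?gt_eqF// powRr1. Qed.

Lemma wmean_le (a b C : R) : 0 <= C ->
  (1 - t) * a `^ q + t * b `^ q <= C `^ q -> wmean q t a b <= C.
Proof.
move=> C0 le_C; have <- : (C `^ q) `^ (1 / q) = C.
  by rewrite -powRrM div1r mulfV ?gt_eqF// powRr1.
by rewrite ge0_ler_powR ?nnegrE ?powR_ge0 ?divr_ge0 ?(ltW q0).
Qed.

Lemma ler_wmean (a b c d : R) : 0 <= a -> a <= c -> 0 <= b -> b <= d ->
  wmean q t a b <= wmean q t c d.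
Proof.
move=> a0 ac b0 bd; case/andP: (t01) => t0 t1.
apply: wmean_le; rewrite ?powR_ge0// wmean_powR.
by rewrite lerD// ler_wpM2l ?subr_ge0// ge0_ler_powR ?nnegrE ?(ltW q0)//
  (le_trans _ ac, le_trans _ bd).
Qed.

(** Jensen's inequality for [s ^ q]: [(x + y) / (A + B)] is the convex combination of [x / A] and
    [y / B] with weights [A / (A + B)] and [B / (A + B)]. The bound is linear in [x ^ q] and
    [y ^ q], with coefficients depending only on [A] and [B], so it can be summed over the two
    coordinates. *)
Let powRD_le (A B x y : R) : 0 < A -> 0 < B -> 0 <= x -> 0 <= y ->
  (x + y) `^ q <= (A + B) `^ q *
    (A / (A + B) * (x `^ q / A `^ q) + B / (A + B) * (y `^ q / B `^ q)).
Proof.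
move=> A0 B0 x0 y0.
have AB0 : 0 < A + B by rewrite addr_gt0.
have divE z C : 0 <= z -> 0 < C -> z `^ q / C `^ q = (z / C) `^ q.
  move=> z0 C0; apply/(canLR (mulfK _)); first by rewrite gt_eqF ?powR_gt0.
  by rewrite -powRM ?divr_ge0 ?(ltW C0)// divfK ?gt_eqF.
have l01 : 0 <= B / (A + B) <= 1.
  rewrite divr_ge0 ?(ltW AB0) ?(ltW B0)//=.
  by rewrite ler_pdivrMr// mul1r lerDr ltW.
have lE : A / (A + B) = 1 - B / (A + B) by field; rewrite gt_eqF.
have [xA0 yB0] : 0 <= x / A /\ 0 <= y / B
  by rewrite !divr_ge0 ?(ltW A0) ?(ltW B0).
rewrite !divE// lE.
have -> : x + y =
    (A + B) * ((1 - B / (A + B)) * (x / A) + B / (A + B) * (y / B)).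
  by field; rewrite !gt_eqF.
have /andP[l0 l1] := l01.
rewrite powRM ?(ltW AB0)//; first by rewrite ler_wpM2l ?powR_ge0// powR_conv_le.
by rewrite addr_ge0// mulr_ge0// subr_ge0.
Qed.

(** Minkowski's inequality by normalization. Upper bounds [A] and [B] stand in for the two norms,
    which may vanish and could then not be divided by. *)
Let wmeanD_gt0 (A B a b c d : R) : 0 < A -> 0 < B ->
  0 <= a -> 0 <= b -> 0 <= c -> 0 <= d ->
  wmean q t a b <= A -> wmean q t c d <= B ->
  wmean q t (a + c) (b + d) <= A + B.
Proof.
move=> A0 B0 a0 b0 c0 d0 leA leB; case/andP: (t01) => t0 t1.
have AB0 : 0 < A + B by rewrite addr_gt0.
have normalized x y C : 0 < C -> wmean q t x y <= C ->
    ((1 - t) * x `^ q + t * y `^ q) / C `^ q <= 1.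
  move=> C0 leC; rewrite ler_pdivrMr ?powR_gt0// mul1r -wmean_powR.
  by rewrite ge0_ler_powR ?nnegrE ?powR_ge0 ?(ltW q0) ?(ltW C0).
have SA := normalized a b A A0 leA.
have SB := normalized c d B B0 leB.
apply: wmean_le; first exact: ltW.
have s0 : 0 <= 1 - t by rewrite subr_ge0.
apply: (le_trans (lerD (ler_wpM2l s0 (powRD_le A B a c A0 B0 a0 c0))
                       (ler_wpM2l t0 (powRD_le A B b d A0 B0 b0 d0)))).
set K := (A + B) `^ q.
(* Exchanging the two sums collects the [q]-th powers of the norms of [(a, b) / A] and [(c, d) / B],
   each at most 1 by [SA] and [SB]. *)
have -> (l m x y z w v v' : R) :
    (1 - t) * (K * (l * (x / v) + m * (z / v')))
    + t * (K * (l * (y / v) + m * (w / v')))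
    = K * (l * (((1 - t) * x + t * y) / v)
           + m * (((1 - t) * z + t * w) / v')) by ring.
(* The weights add up to 1; with [K] split along them, the two sides compare term by term. *)
have {2}-> : K = K * (A / (A + B) * 1 + B / (A + B) * 1).
  by field; rewrite gt_eqF.
rewrite ler_wpM2l ?powR_ge0//.
by rewrite lerD// ler_wpM2l// divr_ge0// ltW.
Qed.

Lemma wmeanD (a b c d : R) : 0 <= a -> 0 <= b -> 0 <= c -> 0 <= d ->
  wmean q t (a + c) (b + d) <= wmean q t a b + wmean q t c d.
Proof.
move=> a0 b0 c0 d0.
(* The slack [e] makes both normalizing constants positive. *)
apply/ler_addgt0Pr => e e0.
have e20 : 0 < e / 2 by rewrite divr_gt0.
rewrite [e]splitr addrACA.
by apply: wmeanD_gt0 => //; rewrite ?lerDl ?ltr_wpDl ?powR_ge0// ltW.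
Qed.

(** Reverse triangle inequality: since [x <= |x - z| + z], monotonicity in each entry followed by
    [wmeanD] gives one sign, and exchanging the two pairs gives the other. *)
Lemma wmean_dist (a b c d : R) : 0 <= a -> 0 <= b -> 0 <= c -> 0 <= d ->
  `|wmean q t a b - wmean q t c d| <= wmean q t `|a - c| `|b - d|.
Proof.
have half (x y z w : R) : 0 <= x -> 0 <= y -> 0 <= z -> 0 <= w ->
    wmean q t x y - wmean q t z w <= wmean q t `|x - z| `|y - w|.
  move=> x0 y0 z0 w0; rewrite lerBlDr.
  apply: le_trans (wmeanD _ _ _ _ (normr_ge0 _) (normr_ge0 _) z0 w0).
  by apply: ler_wmean => //; rewrite -lerBlDr ler_norm.
move=> a0 b0 c0 d0; rewrite ler_norml half// andbT lerNl opprB.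
by rewrite (distrC a) (distrC b) half.
Qed.

Lemma wmean_powR_le (p a b : R) : q <= p -> 0 <= a -> 0 <= b ->
  wmean q t a b `^ p <= (1 - t) * a `^ p + t * b `^ p.
Proof.
move=> qp a0 b0.
(* Splitting off the factor [q] cancels the outer root and leaves the exponent [p / q >= 1] on a
   convex combination of [a ^ q] and [b ^ q]. *)
have pE : p = q * (p / q) by rewrite mulrC divfK ?gt_eqF.
rewrite pE !(powRrM _ q) wmean_powR.
by rewrite powR_conv_le ?powR_ge0// ler_pdivlMr// mul1r.
Qed.

End WeightedMean.

Theorem proposition4p1 (R : realType) (N : nat) (p q : R)
    (hp : 1 < p) (hq : 1 < q) (hqp : q <= p)
    (u0 u1 : 'rV[R]_N -> R)
    (hu0 : forall x, 0 <= u0 x) (hu1 : forall x, 0 <= u1 x) :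
  forall t : R, 0 <= t <= 1 -> forall x y : 'rV[R]_N,
    `|sigma q u0 u1 t x - sigma q u0 u1 t y| `^ p
    <= (1 - t) * `|u0 x - u0 y| `^ p + t * `|u1 x - u1 y| `^ p.
Proof.
move=> t t01 x y.
apply: le_trans (wmean_powR_le (ltW hq) t01 _ _ _ hqp _ _) => //.
rewrite ge0_ler_powR ?nnegrE ?powR_ge0 ?normr_ge0//.
  by rewrite (le_trans ler01)// ltW.
(* [sigma] at a point is convertible to [wmean] of the values of [u0] and [u1] there. *)
exact: wmean_dist (ltW hq) t01 _ _ _ _ _ _ _ _.
Qed.
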